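(* Let $m\geq k\geq 1$ be integers. Let $\mathcal B$ be an $\alpha$-approximation algorithm for the minimum weight $m$-fold dominating set problem and $\mathcal A$ a $\gamma$-approximation algorithm for MNW$k$CSN. Then Algorithm 2 is an approximation algorithm for $(k,m)$-MWCDS on unit disk graphs with performance ratio $\alpha+\gamma$.
   Context: A unit disk graph: nodes are points in the plane, edge iff Euclidean distance at most one. For a graph $G=(V,E)$ with node weights $c:V\to\mathbb R^+$ and $D\subseteq V$, $c(D)=\sum_{v\in D}c(v)$. $D$ is an $m$-fold dominating set if every node of $V\setminus D$ has at least $m$ neighbors in $D$. $D$ is a $(k,m)$-CDS if it is an $m$-fold dominating set and $G[D]$ is $k$-connected. $(k,m)$-MWCDS: find a $(k,m)$-CDS of minimum weight. Minimum weight $m$-fold dominating set problem: find an $m$-fold dominating set of minimum weight. MNW$k$CSN: given a $k$-connected graph with nonnegative node weights and terminal set $T$, find $C\subseteq V\setminus T$ with $G[T\cup C]$ $k$-connected minimizing $c(C)$. Algorithm 2 (input: unit disk graph $G$ with node weights, $\mathcal B$, $\mathcal A$): (1) apply $\mathcal B$ to compute an $m$-fold dominating set $D$ of $G$; (2) reweight the nodes of $D$ to weight zero and apply $\mathcal A$ with terminal set $D$ to compute a $k$-connected subgraph $F$ of $G$ containing $D$; (3) output $V(F)$. *)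

(* Defs.v *)
From mathcomp Require Import all_boot all_order all_algebra.
From mathcomp Require Import reals.

Set Implicit Arguments.
Unset Strict Implicit.
Unset Printing Implicit Defensive.

Import Order.TTheory GRing.Theory Num.Theory.
Local Open Scope ring_scope.

Record sgraph := SGraph {
  vertex :> finType;
  edge : rel vertex;
  edge_sym : symmetric edge;
  edge_irrefl : irreflexive edge
}.

Definition euclidean_dist (R : realType) (p q : R * R) : R :=
  Num.sqrt ((p.1 - q.1) ^+ 2 + (p.2 - q.2) ^+ 2).

Definition unit_disk_graph (R : realType) (G : sgraph) : Prop :=
  exists2 p : G -> R * R, injective p &
    forall u v : G, edge u v = (u != v) && (euclidean_dist (p u) (p v) <= 1).

Definition induced_connected (G : sgraph) (S : {set G}) : Prop :=
  S != set0 /\ {in S &, forall u v, connect [rel x y in S | edge x y] u v}.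

(* [G[S]] is k-connected: it has more than k vertices and deleting fewer than k
   of them leaves a connected graph.  As usual for dominating sets (a single
   dominating node is a connected dominating set), the one-vertex graph is
   1-connected, so that 1-connected means connected and nonempty. *)
Definition k_connected (k : nat) (G : sgraph) (S : {set G}) : Prop :=
  ((k < #|S|)%N \/ (k <= 1)%N /\ #|S| = 1%N) /\
  forall X : {set G}, X \subset S -> (#|X| < k)%N ->
    induced_connected (S :\: X).

Definition m_fold_dominating (m : nat) (G : sgraph) (D : {set G}) : Prop :=
  forall v : G, v \notin D -> (m <= #|[set u in D | edge v u]|)%N.

Definition km_CDS (k m : nat) (G : sgraph) (D : {set G}) : Prop :=
  m_fold_dominating m D /\ k_connected k D.

Definition set_weight (R : realType) (G : sgraph) (c : G -> R) (D : {set G}) :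
  R := \sum_(v in D) c v.

(* Solutions are sets of vertices of the input graph.  [admissible] is the
   promise on the inputs of the problem; the input size is the number of nodes
   (unit cost per real number). *)
Record min_problem (R : realType) := MinProblem {
  instance : Type;
  input_graph : instance -> sgraph;
  admissible : instance -> Prop;
  feasible : forall I : instance, {set input_graph I} -> Prop;
  cost : forall I : instance, {set input_graph I} -> R
}.

Definition optimal (R : realType) (P : min_problem R) (I : instance P)
    (S : {set input_graph I}) : Prop :=
  feasible S /\
  forall S' : {set input_graph I}, feasible S' -> cost S <= cost S'.

(* No machine model is fixed: an algorithm is an input-output map together with
   the number of steps it takes on each input. *)
Record algorithm (R : realType) (P : min_problem R) := Algorithm {
  run : forall I : instance P, {set input_graph I};
  steps : instance P -> nat
}.

Definition polynomial_time (R : realType) (P : min_problem R)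
    (A : algorithm P) : Prop :=
  exists a d : nat, forall I : instance P,
    admissible I -> (exists S : {set input_graph I}, feasible S) ->
    (steps A I <= a * #|input_graph I| ^ d + a)%N.

Definition approximation_algorithm (R : realType) (P : min_problem R)
    (ratio : R) (A : algorithm P) : Prop :=
  [/\ 1 <= ratio,
      polynomial_time A &
      forall I : instance P,
        admissible I -> (exists S : {set input_graph I}, feasible S) ->
        feasible (run A I) /\
        forall S : {set input_graph I}, optimal S ->
          cost (run A I) <= ratio * cost S].

Record weighted_graph (R : realType) := WeightedGraph {
  wgraph : sgraph;
  weight : wgraph -> R
}.

Record steiner_instance (R : realType) := SteinerInstance {
  steiner_graph : sgraph;
  steiner_weight : steiner_graph -> R;
  terminals : {set steiner_graph}
}.

(* In the three problems, [cls] is the class of graphs allowed as inputs. *)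

Definition min_weight_dominating (R : realType) (cls : sgraph -> Prop)
    (m : nat) : min_problem R :=
  {| instance := weighted_graph R;
     input_graph := fun I => wgraph I;
     admissible := fun I => cls (wgraph I) /\ forall v, 0 < @weight R I v;
     feasible := fun I D => m_fold_dominating m D;
     cost := fun I D => set_weight (@weight R I) D |}.

Definition MWCDS (R : realType) (cls : sgraph -> Prop) (k m : nat) :
    min_problem R :=
  {| instance := weighted_graph R;
     input_graph := fun I => wgraph I;
     admissible := fun I => cls (wgraph I) /\ forall v, 0 < @weight R I v;
     feasible := fun I D => km_CDS k m D;
     cost := fun I D => set_weight (@weight R I) D |}.

Definition MNWkCSN (R : realType) (cls : sgraph -> Prop) (k : nat) :
    min_problem R :=
  {| instance := steiner_instance R;
     input_graph := fun I => steiner_graph I;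
     admissible := fun I =>
       [/\ cls (steiner_graph I),
           k_connected k [set: steiner_graph I] &
           forall v, 0 <= @steiner_weight R I v];
     feasible := fun I C =>
       C \subset ~: terminals I /\ k_connected k (terminals I :|: C);
     cost := fun I C => set_weight (@steiner_weight R I) C |}.

Definition reweight (R : realType) (G : sgraph) (c : G -> R) (D : {set G}) :
  G -> R := fun v => if v \in D then 0 else c v.

Definition reweighted_instance (R : realType) (I : weighted_graph R)
    (D : {set wgraph I}) : steiner_instance R :=
  {| steiner_graph := wgraph I;
     steiner_weight := reweight (@weight R I) D;
     terminals := D |}.

(* The subgraph F is the one induced by D and the set of non-terminals returned
   by [A].  Besides the two calls, one step per node is charged for reweighting
   and one for forming V(F). *)
Definition algorithm2 (R : realType) (clsB clsA : sgraph -> Prop) (k m : nat)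
    (B : algorithm (min_weight_dominating R clsB m))
    (A : algorithm (MNWkCSN R clsA k)) :
    algorithm (MWCDS R (unit_disk_graph R) k m) :=
  @Algorithm R (MWCDS R (unit_disk_graph R) k m)
    (fun I : weighted_graph R =>
       let D : {set wgraph I} := run B I in
       D :|: run A (reweighted_instance D))
    (fun I : weighted_graph R =>
       let D : {set wgraph I} := run B I in
       (steps B I + steps A (reweighted_instance D) + 2 * #|wgraph I|)%N).

(* Main.v *)
(** An optimal (k,m)-CDS [S] is an m-fold dominating set, so the set [D] computed
    by [B] weighs at most [alpha * c(S)].  Adding to a k-connected set nodes with
    at least k neighbours in it keeps it k-connected; since [m >= k], the set
    [D :|: S] is k-connected, so [S :\: D] is a feasible augmentation of the
    terminal set [D], and the augmentation computed by [A] weighs at most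
    [gamma * c(S)]. *)
Require Import Defs.
From mathcomp Require Import all_boot all_order all_algebra.
From mathcomp Require Import boolp reals.
From mathcomp Require Import zify.
Local Open Scope ring_scope.

Set Implicit Arguments.
Unset Strict Implicit.
Unset Printing Implicit Defensive.

Import Order.TTheory GRing.Theory Num.Theory.

Lemma m_fold_dominatingS (m : nat) (G : sgraph) (D D' : {set G}) :
  D \subset D' -> m_fold_dominating m D -> m_fold_dominating m D'.
Proof.
move=> sDD' domD v vD'.
have vD : v \notin D by apply: contra vD' => /(subsetP sDD').
apply: leq_trans (domD v vD) _; apply/subset_leq_card/subsetP => u.
by rewrite !inE => /andP[/(subsetP sDD') -> ->].
Qed.

(** Two vertices of [T] are joined by stepping into [S], walking inside [S], and stepping back out,
    which the symmetry of [edge] allows. *)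
Lemma induced_connectedS (G : sgraph) (S T : {set G}) :
  S \subset T -> {in T :\: S, forall v, exists2 u, u \in S & edge v u} ->
  induced_connected S -> induced_connected T.
Proof.
move=> sST attach [/set0Pn[x xS] connS]; split.
  by apply/set0Pn; exists x; rewrite (subsetP sST).
pose e := [rel x y in T | edge x y].
have e_sym : connect_sym e.
  by apply: sym_connect_sym => u v /=; rewrite edge_sym [(u \in T) && _]andbC.
have connST : {in S &, forall u v, connect e u v}.
  move=> u v uS vS; apply: connect_sub (connS u v uS vS) => a b /=.
  case/andP=> /andP[aS bS] ab; apply: connect1.
  by rewrite /= !(subsetP sST).
have to_S v : v \in T -> exists2 u, u \in S & connect e v u.
  move=> vT; have [vS|vS] := boolP (v \in S); first by exists v.
  have [|u uS vu] := attach v; first by rewrite inE vS.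
  by exists u => //; apply: connect1; rewrite /= vT vu (subsetP sST).
move=> u v /to_S[u' u'S uu'] /to_S[v' v'S vv'].
apply: connect_trans uu' _; apply: connect_trans (connST _ _ u'S v'S) _.
by rewrite e_sym.
Qed.

(** Deleting fewer than [k] vertices leaves what remains of [S] connected, and every surviving
    vertex outside [S] keeps one of its [k] neighbours there. *)
Lemma k_connectedS (k : nat) (G : sgraph) (S T : {set G}) :
  S \subset T -> m_fold_dominating k S -> k_connected k S -> k_connected k T.
Proof.
move=> sST domS [cardS connS]; split.
  by move: (subset_leq_card sST); lia.
move=> X sXT ltXk.
have SX : induced_connected (S :\: X).
  (* [X] lies in [T] but perhaps not in [S], so the hypothesis on [S] is applied to its trace on
     [S]. *)
  have -> : S :\: X = S :\: (S :&: X) by rewrite setDIr setDv set0U.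
  apply: connS; first exact: subsetIl.
  exact: leq_ltn_trans (subset_leq_card (subsetIr _ _)) ltXk.
apply: induced_connectedS SX; first exact: setSD.
move=> v; rewrite !inE => /andP[vSX /andP[vX _]].
have /domS leNk : v \notin S by move: vSX; rewrite vX.
have [|u] := @subsetPn _ [set u in S | edge v u] X _.
  by apply/negP => /subset_leq_card; lia.
by rewrite inE => /andP[uS vu] uX; exists u; rewrite // inE uX.
Qed.

(** Vertex sets are finite in number; [feasible] is only a [Prop], hence the classical
    reflection. *)
Lemma exists_optimal (R : realType) (P : min_problem R) (I : instance P) :
  (exists S : {set input_graph I}, feasible S) ->
  exists S : {set input_graph I}, optimal S.
Proof.
move=> [S0 /asboolP S0P].
case: (@arg_minP _ _ _ S0 (fun S => `[< feasible S >]) (@cost R P I) S0P).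
move=> S /asboolP SP minS; exists S; split=> // S' S'P.
by apply: minS; apply/asboolP.
Qed.

(** The guarantee compares with optimal solutions only, whereas an optimal (k,m)-CDS yields merely
    feasible solutions of the two subproblems. *)
Lemma approximation_le (R : realType) (P : min_problem R) (ratio : R)
    (A : algorithm P) (I : instance P) (S : {set input_graph I}) :
  approximation_algorithm ratio A -> admissible I -> feasible S ->
  cost (run A I) <= ratio * cost S.
Proof.
move=> [ratio1 _ approxA] admI fS.
have exS : exists S : {set input_graph I}, feasible S by exists S.
have [S' optS'] := exists_optimal exS.
have [_ /(_ _ optS') leS'] := approxA I admI exS.
apply: le_trans leS' _; rewrite ler_wpM2l ?(le_trans ler01) //.
exact: optS'.2.
Qed.

Lemma set_weight_subset (R : realType) (G : sgraph) (c : G -> R)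
    (S T : {set G}) :
  (forall v, 0 <= c v) -> S \subset T -> set_weight c S <= set_weight c T.
Proof.
move=> c0 sST; rewrite /set_weight (big_setID S (A := T)) /= (setIidPr sST).
by rewrite lerDl sumr_ge0.
Qed.

Lemma set_weight_reweight (R : realType) (G : sgraph) (c : G -> R)
    (D C : {set G}) :
  C \subset ~: D -> set_weight (reweight c D) C = set_weight c C.
Proof.
move=> sCD; apply: eq_bigr => v /(subsetP sCD).
by rewrite inE /reweight => /negbTE ->.
Qed.

Lemma set_weightU (R : realType) (G : sgraph) (c : G -> R) (D C : {set G}) :
  C \subset ~: D ->
  set_weight c (D :|: C) = set_weight c D + set_weight c C.
Proof.
rewrite -disjoints_subset disjoint_sym => disDC.
rewrite /set_weight -bigU //=.
by apply: eq_bigl => v; rewrite !inE.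
Qed.

Lemma polynomial_bound_add (a1 d1 a2 d2 n : nat) :
  ((a1 * n ^ d1 + a1) + (a2 * n ^ d2 + a2) + 2 * n <=
   (a1 + a2 + 1).*2 * n ^ (d1 + d2 + 1) + (a1 + a2 + 1).*2)%N.
Proof.
have [->|n_gt0] := posnP n.
  (* As [0 ^ 0] is 1, the left side can reach [2 * (a1 + a2)] at [n = 0]; the doubled additive
     constant absorbs it. *)
  have le1 d : (0 ^ d <= 1)%N by case: d => // d; rewrite exp0n.
  have := leq_mul (leqnn a1) (le1 d1); have := leq_mul (leqnn a2) (le1 d2).
  lia.
have le1 : (n ^ d1 <= n ^ (d1 + d2 + 1))%N by rewrite leq_pexp2l //; lia.
have le2 : (n ^ d2 <= n ^ (d1 + d2 + 1))%N by rewrite leq_pexp2l //; lia.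
have le3 : (n ^ 1 <= n ^ (d1 + d2 + 1))%N by rewrite leq_pexp2l //; lia.
rewrite expn1 in le3.
have := leq_mul (leqnn a1) le1; have := leq_mul (leqnn a2) le2.
nia.
Qed.

Lemma km_CDS_k_connectedS (k m : nat) (G : sgraph) (S T : {set G}) :
  (k <= m)%N -> km_CDS k m S -> S \subset T -> k_connected k T.
Proof.
move=> k_le_m [domS connS] sST; apply: k_connectedS sST _ connS => v vS.
exact: leq_trans k_le_m (domS v vS).
Qed.

(** The promise that the whole graph is k-connected comes from growing [S] to all vertices. *)
Lemma reweighted_admissible (R : realType) (cls : sgraph -> Prop) (k m : nat)
    (I : weighted_graph R) (D S : {set wgraph I}) :
  (k <= m)%N -> cls (wgraph I) -> (forall v, 0 < @weight R I v) ->
  km_CDS k m S -> @admissible R (MNWkCSN R cls k) (reweighted_instance D).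
Proof.
move=> k_le_m clsI weight_gt0 S_CDS; split=> //.
  exact: km_CDS_k_connectedS k_le_m S_CDS (subsetT _).
by move=> v; rewrite /= /reweight; case: ifP => // _; apply: ltW.
Qed.

(** Terminals and augmentation together form a superset of [S], so k-connectivity carries over from
    [S]. *)
Lemma reweighted_feasible (R : realType) (cls : sgraph -> Prop) (k m : nat)
    (I : weighted_graph R) (D S : {set wgraph I}) :
  (k <= m)%N -> km_CDS k m S ->
  @feasible R (MNWkCSN R cls k) (reweighted_instance D) (S :\: D).
Proof.
move=> k_le_m S_CDS; split; first by rewrite setDE subsetIr.
apply: km_CDS_k_connectedS k_le_m S_CDS _; apply/subsetP => v vS.
by rewrite !inE vS andbT orbN.
Qed.

Theorem theorem2 (R : realType) (k m : nat)
  (k_ge1 : (1 <= k)%N) (k_le_m : (k <= m)%N) (alpha gamma : R)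
  (clsB clsA : sgraph -> Prop)
  (udg_clsB : forall G : sgraph, unit_disk_graph R G -> clsB G)
  (udg_clsA : forall G : sgraph, unit_disk_graph R G -> clsA G)
  (B : algorithm (min_weight_dominating R clsB m))
  (A : algorithm (MNWkCSN R clsA k)) :
  approximation_algorithm alpha B ->
  approximation_algorithm gamma A ->
  approximation_algorithm (alpha + gamma) (algorithm2 B A).
Proof.
move=> approxB approxA.
have [alpha1 [aB [dB timeB]] correctB] := approxB.
have [gamma1 [aA [dA timeA]] correctA] := approxA.
split.
- by rewrite (le_trans alpha1) // lerDl (le_trans ler01).
- exists (aB + aA + 1).*2%N, (dB + dA + 1)%N => I [udgI weight_gt0] [S S_CDS].
  apply: leq_trans (polynomial_bound_add _ _ _ _ _).
  rewrite leq_add2r leq_add //.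
    by apply: timeB; [split=> //; apply: udg_clsB | exists S; case: S_CDS].
  apply: (timeA (reweighted_instance (run B I))).
    exact: reweighted_admissible k_le_m (udg_clsA _ udgI) weight_gt0 S_CDS.
  exists (S :\: run B I); exact: reweighted_feasible k_le_m S_CDS.
- move=> I [udgI weight_gt0] [S S_CDS].
  have admB : @admissible R (min_weight_dominating R clsB m) I.
    by split=> //; apply: udg_clsB.
  have [domD _] := correctB I admB (ex_intro _ S S_CDS.1).
  set D := run B I in domD *; pose J := reweighted_instance D.
  have admA : @admissible R (MNWkCSN R clsA k) J.
    exact: reweighted_admissible k_le_m (udg_clsA _ udgI) weight_gt0 S_CDS.
  have feasA S' : km_CDS k m S' ->
      @feasible R (MNWkCSN R clsA k) J (S' :\: D).
    exact: reweighted_feasible.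
  have [[sCD connDC] _] := correctA J admA (ex_intro _ _ (feasA S S_CDS)).
  split; first by split=> //; apply: m_fold_dominatingS domD; apply: subsetUl.
  move=> S' [S'_CDS _].
  have leD := approximation_le approxB admB S'_CDS.1.
  have leC := approximation_le approxA admA (feasA S' S'_CDS).
  (* The augmentation avoids [D], so the two weights add up, and reweighting leaves the cost of the
     augmentation unchanged. *)
  rewrite /= set_weightU // mulrDl lerD // -(set_weight_reweight _ sCD).
  apply: le_trans leC _; rewrite ler_wpM2l ?(le_trans ler01) //=.
  (* [S' :\: D] also avoids [D], so its reweighted cost is its original weight, at most that of
     [S']. *)
  rewrite set_weight_reweight ?(feasA S' S'_CDS).1 //.
  by apply: set_weight_subset; [move=> v; apply: ltW | apply: subsetDl].
Qed.
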